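(* Let $n\in\mathbb{N}$, let $\alpha_i>0$ and $x_i>0$ ($i=1,\ldots,n$) be real numbers with $\sum_{i=1}^n\alpha_i=1$, and suppose that the $x_i$ are not all equal. Let $$h=\Big(\sum_{i=1}^n\frac{\alpha_i}{x_i}\Big)^{-1},\qquad g=\prod_{i=1}^n x_i^{\alpha_i},\qquad a=\sum_{i=1}^n\alpha_i x_i,\qquad \alpha=\min_i\{\alpha_i\}.$$ Let $\xi_0\in[0,1]$ and $\xi_1\in[1,1/\alpha]$ be the (unique) solutions in these respective intervals of the equation $$g=a\,\xi^{\alpha}\left(\frac{1-\alpha\xi}{1-\alpha}\right)^{1-\alpha}.$$ Then $$a\,\frac{\xi_0(1-\alpha\xi_0)}{\alpha-2\alpha\xi_0+\xi_0}\;\le\; h\;\le\; a\,\frac{\xi_1(1-\alpha\xi_1)}{\alpha-2\alpha\xi_1+\xi_1}.$$ Moreover, the first (resp. second) inequality is an equality if and only if there is an index $j$ with $\alpha_j=\min_i\{\alpha_i\}$ such that $x_j=a\,\xi_0$ (resp. $x_j=a\,\xi_1$) and $x_l=x_k$ for all $l,k\neq j$.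
   Context: The quantities $h$, $g$, $a$ are the weighted harmonic, geometric and arithmetic means of the $x_i$ with weights $\alpha_i$. Since the $x_i$ are not all equal, $n\ge 2$ and hence $0<\alpha\le 1/2$. *)

(* Defs.v *)
From HB Require Import structures.
From mathcomp Require Import all_boot all_order all_algebra.
From mathcomp Require Import reals exp.
Set Implicit Arguments.
Unset Strict Implicit.
Unset Printing Implicit Defensive.
Import Order.TTheory GRing.Theory Num.Theory.
Local Open Scope ring_scope.

Definition harmonic_mean (R : realType) (n : nat) (w x : 'I_n -> R) : R :=
  (\sum_(i < n) w i / x i)^-1.

Definition geometric_mean (R : realType) (n : nat) (w x : 'I_n -> R) : R :=
  \prod_(i < n) x i `^ w i.

Definition arithmetic_mean (R : realType) (n : nat) (w x : 'I_n -> R) : R :=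
  \sum_(i < n) w i * x i.

(* The default value 1 is never below the minimum of a family of positive
   weights of sum 1, so it does not affect the result in that case. *)
Definition min_weight (R : realType) (n : nat) (w : 'I_n -> R) : R :=
  \big[Num.min/1]_(i < n) w i.

(* Both bases are nonnegative for 0 <= xi <= alpha^-1, and 0 `^ r = 0 for
   r != 0, so powR is the usual real power at both endpoints. *)
Definition mean_equation (R : realType) (g a alpha xi : R) : Prop :=
  g = a * xi `^ alpha * ((1 - alpha * xi) / (1 - alpha)) `^ (1 - alpha).

Definition harmonic_bound (R : realType) (a alpha xi : R) : R :=
  a * (xi * (1 - alpha * xi) / (alpha - 2 * alpha * xi + xi)).

Definition extremal_config (R : realType) (n : nat) (w x : 'I_n -> R)
    (v : R) : Prop :=
  exists j : 'I_n, [/\ w j = min_weight w, x j = v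
    & forall l k : 'I_n, l != j -> k != j -> x l = x k].

(* Main.v *)
From HB Require Import structures.
From mathcomp Require Import all_boot all_order all_algebra.
From mathcomp Require Import ring lra.
From mathcomp Require Import classical_sets reals sequences exp topology.
From mathcomp Require Import normedtype derive realfun.
(* Required last, so that [arithmetic_mean] is the weighted mean defined there
   and not the mean of a sequence. *)
Require Import Defs.
Set Implicit Arguments.
Unset Strict Implicit.
Unset Printing Implicit Defensive.
Import Order.TTheory GRing.Theory Num.Theory.
Import numFieldNormedType.Exports.
Local Open Scope ring_scope.

(** Put [p = a * xi] and [v = a * (1 - alpha * xi) / (1 - alpha)].  The equation
defining [xi] says that the two-point distribution with mass [alpha] at [p] and
[1 - alpha] at [v] has the same arithmetic and geometric means as the family
[x], and [harmonic_bound a alpha xi] is the harmonic mean of that distribution.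
So two distributions with equal integrals of [1], [t] and [ln t] are compared on
[1 / t].

The comparison is made by integrating one well-chosen test function [f].
Suppose [f v <= f (x i)] for all [i] and [f p <= f (x j)] for one index [j].
Since [alpha <= w j], the sum of the [w i * f (x i)] is at least
[w j * f (x j) + (1 - w j) * f v >= alpha * f (x j) + (1 - alpha) * f v
>= alpha * f p + (1 - alpha) * f v], and equality forces all the mass other than
[w j = alpha] to sit at [v] ([two_point_le]).  It is used twice.

With [f t = t / v - ln t] both sides agree, so [f p < f (x j)] is impossible:
an atom of mass at least [alpha] cannot lie strictly beyond [p] as seen from [v]
([single_crossing]).  Applied to two two-point distributions this also gives the
uniqueness of [xi0] and [xi1].  They exist by the intermediate value theorem:
the right-hand side of the equation vanishes at [0] and at [alpha^-1], and at
[1] it is the arithmetic mean, which is at least the geometric one.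

Now let [u = x j] be the smallest of the [x i] in the case of [xi0], the largest
in the case of [xi1]; then every [x i] lies on the same side of [u] as [v], and
[p] lies on the other side by the previous paragraph.  Take for [f] the
function with derivative [(v - u) * (1 / t - 1 / u) * (1 / t - 1 / v)].  It has a
strict minimum at [v] among the points on the side of [v], and it decreases
from [u] towards [p].  As [f] is a combination of [t], [ln t] and
[- (v - u) / t], the inequality for [f] is the inequality for the harmonic means,
with its sign given by that of [v - u] ([harmonic_comparison]). *)

(** * Logarithm inequalities and the test function *)

Section TwoPointComparison.
Variable R : realType.
Implicit Types s t u v p a : R.

Lemma ln_lt_sub1 t : 0 < t -> t != 1 -> ln t < t - 1.
Proof.
move=> t_gt0 t_neq1.
have := @expR_gt1Dx R (ln t); rewrite ln_eq0// lnK// => /(_ t_neq1); lra.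
Qed.

(** The function [t / v - ln t] decreases strictly towards its minimum at [v],
from either side: the sign condition says that [s] is farther from [v] than [t]
on the same side, or that [t = v]. *)
Lemma ln_sub_lt s t v : 0 < s -> 0 < t -> 0 < v -> s != t ->
  0 <= (s - t) * (t - v) -> ln s - ln t < (s - t) / v.
Proof.
move=> s0 t0 v0 st stv; rewrite -ln_div//.
have st0 : 0 < s / t by rewrite divr_gt0.
apply: lt_le_trans (ln_lt_sub1 st0 _) _.
  by apply: contra_neq st => e; rewrite -[s](divfK (lt0r_neq0 t0)) e mul1r.
rewrite -subr_ge0.
have -> : (s - t) / v - (s / t - 1) = (s - t) * (t - v) / (v * t).
  by field; rewrite !gt_eqF.
by rewrite divr_ge0// ltW// mulr_gt0.
Qed.

Lemma ln_sub_le s v : 0 < s -> 0 < v -> ln s - ln v <= (s - v) / v.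
Proof.
move=> s0 v0; have [->|sv] := eqVneq s v; first by rewrite !subrr mul0r.
by rewrite ltW// ln_sub_lt// subrr mulr0.
Qed.

(** The combination of [t], [ln t] and [1 / t] whose derivative is
[(t^-1 - u^-1) * (t^-1 - v^-1)]. *)
Definition test_fun u v t : R := (u * v)^-1 * t - (u^-1 + v^-1) * ln t - t^-1.

Lemma is_derive_test_fun u v t : 0 < t ->
  is_derive t 1 (test_fun u v) ((u * v)^-1 - (u^-1 + v^-1) * t^-1 + t ^- 2).
Proof.
move=> t0.
have dlin := is_deriveZ (u * v)^-1 (is_derive_id t (1 : R)).
have dlog := is_deriveZ (u^-1 + v^-1) (is_derive1_ln t0).
have dinv := is_deriveV (lt0r_neq0 t0) (is_derive_id t (1 : R)).
apply: is_derive_eq (is_deriveB (is_deriveB dlin dlog) dinv) _.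
by rewrite /GRing.scale/= !mulr1 opprK.
Qed.

(** The mean value theorem in a form symmetric in [s] and [t], so that the two
inequalities of the theorem can share one proof; [0 < (c - s) * (t - c)] says
that [c] is strictly between them. *)
Lemma test_fun_sub u v s t : 0 < u -> 0 < v -> 0 < s -> 0 < t -> s != t ->
  exists c, [/\ 0 < c, 0 < (c - s) * (t - c)
    & test_fun u v t - test_fun u v s =
      (c - u) * (c - v) * (t - s) / (c ^+ 2 * (u * v))].
Proof.
move=> u0 v0; wlog st : s t / s < t => [th s0 t0 |s0 t0 _].
  rewrite neq_lt => /orP[|] st; first by apply: th; rewrite // lt_eqF.
  have [||||c [c0 cst e]] := th t s => //; first by rewrite lt_eqF.
  by exists c; split => //; [lra|rewrite -[LHS]opprB e -[t - s]opprB; ring].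
have dtest x : x \in `]s, t[ -> is_derive x 1 (test_fun u v)
    ((u * v)^-1 - (u^-1 + v^-1) * x^-1 + x ^- 2).
  by rewrite in_itv/= => /andP[sx _]; apply/is_derive_test_fun/(lt_trans s0).
have [|c] := MVT st dtest.
  apply: derivable_within_continuous => x; rewrite in_itv/= => /andP[sx _].
  by have [] := @is_derive_test_fun u v x (lt_le_trans s0 sx).
rewrite in_itv/= => /andP[sc ct] ->; exists c.
have c0 := lt_trans s0 sc; split=> //; first by rewrite mulr_gt0 ?subr_gt0.
by field; rewrite !gt_eqF.
Qed.

(** Having the same strict sign is a transitive relation. *)
Lemma mul_gt0_trans s t u : 0 < s * t -> 0 < t * u -> 0 < s * u.
Proof.
move=> st tu; have t2 : 0 < t ^+ 2.
  by rewrite exprn_even_gt0//=; apply: contraTneq st => ->; rewrite mulr0 ltxx.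
rewrite -(pmulr_rgt0 _ t2); have := mulr_gt0 st tu.
by rewrite (_ : s * t * (t * u) = t ^+ 2 * (s * u))//; ring.
Qed.

(** * Comparing a family with a two-point distribution *)

Section Comparison.
Variables (I : finType) (w y : I -> R) (alpha : R) (j : I).
Hypotheses (w_gt0 : forall i, 0 < w i) (w_sum1 : \sum_i w i = 1).
Hypotheses (alpha_gt0 : 0 < alpha) (alpha_le : alpha <= w j).

(** Transport of mass: [alpha] of the mass at [y j] goes to [p], everything else
to [v]. *)
Lemma two_point_excess (f : R -> R) p v :
  \sum_i w i * f (y i) - (alpha * f p + (1 - alpha) * f v) =
  \sum_(i | i != j) w i * (f (y i) - f v) +
  (w j - alpha) * (f (y j) - f v) + alpha * (f (y j) - f p).
Proof.
under [X in _ = X + _ + _]eq_bigr do rewrite mulrBr.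
rewrite sumrB -mulr_suml (bigD1 j)//=.
move: w_sum1; rewrite (bigD1 j)//= => /(canRL (addKr _)) ->; ring.
Qed.

(** Each of the three terms of [two_point_excess] is nonnegative, so a zero
excess kills all of them, and the strict inequalities turn this into the shape
of the family. *)
Lemma two_point_le (f : R -> R) p v :
  y j != v -> (forall i, y i != v -> f v < f (y i)) ->
  (y j != p -> f p < f (y j)) ->
  let D := \sum_i w i * f (y i) - (alpha * f p + (1 - alpha) * f v) in
  0 <= D /\
  (D = 0 -> [/\ w j = alpha, y j = p & forall i, i != j -> y i = v]).
Proof.
move=> yjv fv fp D; rewrite {}/D two_point_excess.
have le_fv i : f v <= f (y i).
  by have [->|/fv/ltW] := eqVneq (y i) v.
have le_fp : f p <= f (y j) by have [->|/fp/ltW] := eqVneq (y j) p.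
set S := \sum_(i | _) _; set T := (w j - _) * _; set U := alpha * _.
have term_ge0 i : i != j -> 0 <= w i * (f (y i) - f v).
  by rewrite mulr_ge0 ?subr_ge0// ltW.
have S0 : 0 <= S by exact: sumr_ge0.
have T0 : 0 <= T by rewrite mulr_ge0 ?subr_ge0.
have U0 : 0 <= U by rewrite mulr_ge0 ?subr_ge0// ltW.
split; first by rewrite !addr_ge0.
move=> /eqP; rewrite !paddr_eq0 ?addr_ge0// => /andP[/andP[/eqP SE TE] UE].
split.
- by move: TE; rewrite mulf_eq0 !subr_eq0 (gt_eqF (fv j yjv)) orbF => /eqP.
- apply: contraTeq UE => /fp lt_fp.
  by rewrite mulf_eq0 subr_eq0 !gt_eqF.
- move=> i ij; have /eqP := psumr_eq0P term_ge0 SE ij.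
  rewrite mulf_eq0 gt_eqF//= subr_eq0; apply: contraTeq => /fv lt_fv.
  by rewrite gt_eqF.
Qed.

End Comparison.

(** Mass [alpha] at [p] and [1 - alpha] at [v] has arithmetic mean [A] and
logarithm of the geometric mean [L]. *)
Definition two_point_match alpha p v A L :=
  [/\ 0 < p, 0 < v, alpha * p + (1 - alpha) * v = A
    & alpha * ln p + (1 - alpha) * ln v = L].

Section Crossing.
Variables (I : finType) (w y : I -> R) (alpha : R) (j : I) (p v : R).
Hypotheses (w_gt0 : forall i, 0 < w i) (w_sum1 : \sum_i w i = 1).
Hypotheses (y_gt0 : forall i, 0 < y i).
Hypotheses (alpha_gt0 : 0 < alpha) (alpha_le : alpha <= w j).
Hypothesis pv_match :
  two_point_match alpha p v (\sum_i w i * y i) (\sum_i w i * ln (y i)).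

(** The excess for [t / v - ln t] vanishes because the means agree, while an atom
[y j] beyond [p] would make it positive. *)
Lemma single_crossing : 0 <= (y j - p) * (p - v) -> y j = p.
Proof.
have [p0 v0 mean_eq log_eq] := pv_match.
move=> side; apply/eqP; apply: contraT => yjp.
have yjv : y j != v.
  apply: contra_neq yjp => e; move: side; rewrite e => side.
  by apply/eqP; rewrite -subr_eq0 -sqrf_eq0 eq_le sqr_ge0 andbT; nra.
pose f t := t / v - ln t.
have fv i : y i != v -> f v < f (y i).
  move=> yiv; have := ln_sub_lt (y_gt0 i) v0 v0 yiv.
  rewrite subrr mulr0 lexx /f mulrBl => /(_ isT); lra.
have fp : y j != p -> f p < f (y j).
  move=> _; have := ln_sub_lt (y_gt0 j) p0 v0 yjp side.
  rewrite /f mulrBl; lra.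
have [_] := two_point_le w_gt0 w_sum1 alpha_gt0 alpha_le yjv fv fp.
case=> [|_ /eqP]; last by rewrite (negPf yjp).
have -> : \sum_i w i * f (y i) =
    (\sum_i w i * y i) / v - \sum_i w i * ln (y i).
  rewrite mulr_suml -sumrB; apply: eq_bigr => i _; rewrite /f; ring.
rewrite -mean_eq -log_eq /f; ring.
Qed.

(** The hypotheses place every [y i], and [v], on one side of [y j], and [p] not
beyond [v]; [single_crossing] then puts [p] on the other side of [y j].  The
factor [v - y j] treats together a smallest [y j] and a largest one. *)
Lemma harmonic_comparison :
  y j != v -> (forall i, 0 <= (y i - y j) * (v - y j)) ->
  0 <= (v - p) * (v - y j) ->
  let D := (v - y j) *
    (alpha / p + (1 - alpha) / v - \sum_i w i / y i) in
  0 <= D /\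
  (D = 0 -> [/\ w j = alpha, y j = p & forall i, i != j -> y i = v]).
Proof.
have [p0 v0 mean_eq log_eq] := pv_match.
move=> yjv outer far.
have uv0 : 0 < (v - y j) ^+ 2 by rewrite exprn_even_gt0//= subr_eq0 eq_sym.
have beyond : y j != p -> 0 < (y j - p) * (v - y j).
  move=> yjp; rewrite ltNge; apply: contra_neqN yjp => le0.
  apply: single_crossing; nra.
pose f t := (v - y j) * test_fun (y j) v t.
have den0 c : 0 < c -> 0 < (c ^+ 2 * (y j * v))^-1.
  by move=> c0; rewrite invr_gt0 !mulr_gt0// exprn_gt0.
have fv i : y i != v -> f v < f (y i).
  rewrite eq_sym => yiv; rewrite -subr_gt0 /f -mulrBr.
  have [c [c0 between ->]] := test_fun_sub (y_gt0 j) v0 v0 (y_gt0 i) yiv.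
  have := den0 c c0; move: (_^-1) => d d0; rewrite mulrA pmulr_lgt0//.
  have side_c : 0 < (c - y j) * (v - y j).
    (* Either [c] is beyond [v], hence on its side of [y j], or it is between
       [y i] and [v], which are both on that side. *)
    have [cv|vc] := leP 0 ((c - v) * (v - y j)); first by nra.
    have ct : 0 < (c - y i) * (v - y j).
      apply: (@mul_gt0_trans _ (v - c)); [move: between; lra|move: vc; lra].
    by have := outer i; nra.
  have side_t : 0 < (c - v) * (y i - v) by have := sqr_ge0 (c - v); nra.
  by have := mulr_gt0 side_c side_t; rewrite [X in _ -> 0 < X](_ : _ =
    (c - y j) * (v - y j) * ((c - v) * (y i - v)))//; ring.
have fp : y j != p -> f p < f (y j).
  move=> yjp; rewrite -subr_gt0 /f -mulrBr.
  have pyj : p != y j by rewrite eq_sym.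
  have [c [c0 between ->]] := test_fun_sub (y_gt0 j) v0 p0 (y_gt0 j) pyj.
  have := den0 c c0; move: (_^-1) => d d0; rewrite mulrA pmulr_lgt0//.
  have side_c : 0 < (y j - c) * (v - y j).
    apply: (@mul_gt0_trans _ (y j - p)); last exact: beyond.
    by have := sqr_ge0 (y j - c); nra.
  have side_v : 0 < (v - c) * (v - y j) by nra.
  have side_p : 0 < (y j - p) * (v - y j) by exact: beyond.
  have side_pv : 0 < (v - c) * (y j - p).
    by apply: (mul_gt0_trans side_v); rewrite mulrC.
  by have := mulr_gt0 side_c side_pv; rewrite [X in _ -> 0 < X](_ : _ =
    (y j - c) * (v - y j) * ((v - c) * (y j - p)))//; ring.
have -> : (v - y j) * (alpha / p + (1 - alpha) / v - \sum_i w i / y i) =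
  \sum_i w i * f (y i) - (alpha * f p + (1 - alpha) * f v).
  set c := (y j * v)^-1; set b := ((y j)^-1 + v^-1).
  have -> : \sum_i w i * f (y i) = (v - y j) * (c * (\sum_i w i * y i) -
      b * (\sum_i w i * ln (y i)) - \sum_i w i / y i).
    rewrite !mulr_sumr -!sumrB mulr_sumr; apply: eq_bigr => i _.
    by rewrite /f /test_fun -/c -/b; ring.
  rewrite -mean_eq -log_eq /f /test_fun -/b -/c; ring.
exact: two_point_le.
Qed.

End Crossing.

(** * Solutions of the mean equation *)

(** Two solutions on the same side of [a] are compared as families of two points
indexed by [bool]; the sign condition says that [s] is the one farther from
[a], and [t - v'] has the sign of [t - a] because [a] is between [t] and
[v']. *)
Lemma two_point_unique alpha a L s v t v' : 0 < alpha < 1 ->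
  two_point_match alpha s v a L -> two_point_match alpha t v' a L ->
  0 <= (s - t) * (t - a) -> s = t.
Proof.
move=> /andP[alpha0 alpha1] [s0 v0 sv_a sv_L] [t0 v'0 tv_a tv_L] side.
pose w b := if b then alpha else 1 - alpha.
pose y b := if b then s else v.
apply: (@single_crossing bool w y alpha true t v') => //.
- by case; rewrite /w//= subr_gt0.
- by rewrite big_bool /w/=; ring.
- by case.
- by rewrite !big_bool/= sv_a sv_L.
- have v'E : t - v' = (t - a) / (1 - alpha).
    by rewrite -tv_a; field; rewrite subr_eq0 gt_eqF.
  by rewrite /= v'E mulrA divr_ge0// subr_ge0 ltW.
Qed.

(** Only the lower point [s <= a] carries the statement; used with [1 - alpha]
in place of [alpha], it provides the solutions where the atom of mass [alpha] is
the upper one. *)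
Lemma two_point_exists alpha a L : 0 < alpha < 1 -> 0 < a -> L <= ln a ->
  exists s v, s <= a /\ two_point_match alpha s v a L.
Proof.
move=> /andP[alpha0 alpha1] a0 La.
have beta0 : 0 < 1 - alpha by rewrite subr_gt0.
pose v s := a / (1 - alpha) - alpha / (1 - alpha) * s.
have vE s : v s = (a - alpha * s) / (1 - alpha) by rewrite /v; ring.
pose f s := alpha * ln s + (1 - alpha) * ln (v s).
have v_gt0 s : s <= a -> 0 < v s.
  by move=> sa; rewrite vE divr_gt0// subr_gt0; nra.
have va : v a = a by rewrite /v; field; exact: lt0r_neq0.
(* [alpha * ln s] tends to [-oo] at [0] while [v s] is at most
   [a / (1 - alpha)], so this explicit [e] already gives [f e <= L]. *)
pose e := Num.min a (expR ((L - (1 - alpha) * ln (a / (1 - alpha))) / alpha)).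
have e0 : 0 < e by rewrite lt_min a0 expR_gt0.
have ea : e <= a by rewrite ge_min lexx.
have fe : f e <= L.
  have le_ln_e : ln e <= (L - (1 - alpha) * ln (a / (1 - alpha))) / alpha.
    by rewrite -ler_expR lnK// ge_min lexx orbT.
  have le_ln_v : ln (v e) <= ln (a / (1 - alpha)).
    rewrite ler_ln ?posrE ?v_gt0 ?divr_gt0// vE ler_pM2r ?invr_gt0//.
    by rewrite gerBl mulr_ge0 ?ltW.
  rewrite ler_pdivlMr// in le_ln_e; rewrite /f.
  have := ler_wpM2l (ltW beta0) le_ln_v; lra.
have fa : L <= f a by rewrite /f va; lra.
have cf : {within `[e, a], continuous f}%classic.
  apply: derivable_within_continuous => s; rewrite in_itv/= => /andP[es sa].
  have s0 : 0 < s := lt_le_trans e0 es.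
  have dv := is_deriveB (is_derive_cst (a / (1 - alpha)) s (1 : R))
    (is_deriveZ (alpha / (1 - alpha)) (is_derive_id s (1 : R))).
  have dlnv := is_derive1_comp (is_derive1_ln (v_gt0 s sa)) dv.
  by have [] := is_deriveD (is_deriveZ alpha (is_derive1_ln s0))
    (is_deriveZ (1 - alpha) dlnv).
have [|s] := IVT ea cf (v := L).
  by rewrite (min_idPl _) ?(max_idPr _) ?fe ?fa// (le_trans fe fa).
rewrite in_itv/= => /andP[es sa] fs; exists s, (v s); split=> //; split.
- exact: lt_le_trans es.
- exact: v_gt0.
- by rewrite /v; field; exact: lt0r_neq0.
- exact: fs.
Qed.

(** Inequality of the arithmetic and geometric means in logarithmic form: the
logarithm is below its tangent at the arithmetic mean. *)
Lemma mean_ln_le (I : finType) (w y : I -> R) : (forall i, 0 < w i) ->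
  \sum_i w i = 1 -> (forall i, 0 < y i) ->
  0 < \sum_i w i * y i ->
  \sum_i w i * ln (y i) <= ln (\sum_i w i * y i).
Proof.
move=> w0 w1 y0; set a := \sum_i _ => a0.
have : \sum_i w i * (ln (y i) - ln a) <= \sum_i w i * ((y i - a) / a).
  by apply: ler_sum => i _; rewrite ler_pM2l ?ln_sub_le.
under eq_bigr do rewrite mulrBr.
under [X in _ <= X]eq_bigr do rewrite mulrA mulrBr.
rewrite -mulr_suml !sumrB -!mulr_suml w1 !mul1r subrr mul0r; lra.
Qed.

(** The values [xi = 0] and [xi = alpha^-1], where the right-hand side vanishes,
are excluded by [0 < g]; elsewhere one can take logarithms. *)
Lemma mean_equationP g a alpha xi : 0 < g -> 0 < a -> 0 < alpha < 1 ->
  0 <= xi <= alpha^-1 ->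
  mean_equation g a alpha xi <->
  two_point_match alpha (a * xi) (a * (1 - alpha * xi) / (1 - alpha)) a (ln g).
Proof.
move=> g0 a0 /andP[alpha0 alpha1] /andP[xi_ge0 xi_le].
have beta0 : 0 < 1 - alpha by rewrite subr_gt0.
have ln_rhs : 0 < xi -> 0 < 1 - alpha * xi ->
    ln (a * xi `^ alpha * ((1 - alpha * xi) / (1 - alpha)) `^ (1 - alpha)) =
    alpha * ln (a * xi) + (1 - alpha) * ln (a * (1 - alpha * xi) / (1 - alpha)).
  move=> xi0 eta0; have eta1 : 0 < (1 - alpha * xi) / (1 - alpha).
    exact: divr_gt0.
  rewrite -[a * _ / _]mulrA 2?lnM ?posrE ?mulr_gt0 ?powR_gt0// !ln_powR.
  by rewrite !(@lnM _ a) ?posrE//; ring.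
split=> [|[]].
  move=> eq_g.
  have xi0 : 0 < xi.
    rewrite lt0r xi_ge0 andbT; apply: contraTneq g0 => xi0.
    by rewrite eq_g xi0 powR0 ?lt0r_neq0// mulr0 mul0r ltxx.
  have eta0 : 0 < 1 - alpha * xi.
    rewrite lt0r subr_ge0 -ler_pdivlMl// mulr1 xi_le andbT.
    apply: contraTneq g0 => eta0.
    by rewrite eq_g eta0 mul0r powR0 ?lt0r_neq0// mulr0 ltxx.
  split.
  - exact: mulr_gt0.
  - by rewrite divr_gt0// mulr_gt0.
  - by field; exact: lt0r_neq0.
  - by rewrite eq_g ln_rhs.
rewrite pmulr_rgt0// => xi0; rewrite -mulrA pmulr_rgt0// pmulr_lgt0 ?invr_gt0//.
move=> eta0 _; rewrite mulrA -ln_rhs// => eq_ln; rewrite /mean_equation.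
by apply/esym/ln_inj; rewrite ?posrE// !mulr_gt0// powR_gt0// divr_gt0.
Qed.

Lemma harmonic_boundE a alpha xi : 0 < a -> 0 < alpha < 1 ->
  0 < xi -> 0 < 1 - alpha * xi ->
  harmonic_bound a alpha xi =
  (alpha / (a * xi) + (1 - alpha) / (a * (1 - alpha * xi) / (1 - alpha)))^-1.
Proof.
move=> a0 /andP[alpha0 alpha1] xi0 eta0; rewrite /harmonic_bound.
have den : 0 < alpha * (1 - alpha * xi) + (1 - alpha) ^+ 2 * xi.
  by rewrite addr_gt0// mulr_gt0// exprn_gt0// subr_gt0.
by field; rewrite !lt0r_neq0 ?subr_gt0// -subr_gt0.
Qed.

(** * The three means of a family *)

Section Means.
Variables (n : nat) (w x : 'I_n -> R).
Hypotheses (w_gt0 : forall i, 0 < w i) (x_gt0 : forall i, 0 < x i).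
Hypothesis w_sum1 : \sum_(i < n) w i = 1.
Hypothesis x_not_all_equal : exists i j : 'I_n, x i <> x j.
Let h := harmonic_mean w x.
Let g := geometric_mean w x.
Let a := arithmetic_mean w x.
Let alpha := min_weight w.

Lemma min_weight_le i : alpha <= w i.
Proof. exact: bigmin_le. Qed.

Lemma min_weight_in01 : 0 < alpha < 1.
Proof.
have [i [j xij]] := x_not_all_equal.
have ij : i != j by apply/eqP => ij; apply: xij; rewrite ij.
apply/andP; split; first by rewrite lt_bigmin.
apply: le_lt_trans (min_weight_le i) _; rewrite -w_sum1 (bigD1 i)//= ltrDl.
rewrite (bigD1 j) 1?eq_sym//= ltr_wpDr// sumr_ge0// => k _; exact: ltW.
Qed.

Lemma ln_geometric_mean : ln g = \sum_i w i * ln (x i).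
Proof.
rewrite -[RHS]expRK expR_sum; congr ln; apply: eq_bigr => i _.
by rewrite /powR gt_eqF.
Qed.

Lemma geometric_mean_gt0 : 0 < g.
Proof. by apply: prodr_gt0 => i _; rewrite powR_gt0. Qed.

Lemma arithmetic_mean_gt0 : 0 < a.
Proof.
have [i _] := x_not_all_equal.
rewrite /a /arithmetic_mean (bigD1 i)//= ltr_wpDr ?mulr_gt0//.
by rewrite sumr_ge0// => k _; rewrite mulr_ge0// ltW.
Qed.

(** The common value of the other [x i] is not prescribed by [extremal_config];
it is forced to be [v] by the arithmetic mean. *)
Lemma harmonic_mean_extremal p v : two_point_match alpha p v a (ln g) ->
  extremal_config w x p -> h = (alpha / p + (1 - alpha) / v)^-1.
Proof.
case=> p0 v0 mean_eq _ [j [wj xj eq_x]].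
have /andP[_ alpha1] := min_weight_in01.
have w_rest : \sum_(i | i != j) w i = 1 - alpha.
  by move: w_sum1; rewrite (bigD1 j)//= wj -/alpha => <-; ring.
have x_rest i : i != j -> x i = v.
  move=> ij; apply: (@mulfI _ (1 - alpha)); first by rewrite subr_eq0 gt_eqF.
  apply: (@addrI _ (alpha * p)); rewrite mean_eq /a /arithmetic_mean.
  rewrite (bigD1 j)//= wj xj -w_rest mulr_suml; congr (_ + _).
  by apply: eq_bigr => k kj; rewrite (eq_x i k).
congr (_^-1); rewrite (bigD1 j)//= wj xj -w_rest mulr_suml; congr (_ + _).
by apply: eq_bigr => i ij; rewrite x_rest.
Qed.

(** The sign of [v - x j] decides which side of [h] the bound is on, while the
case of equality reads the same for both. *)
Lemma harmonic_mean_bound j p v : two_point_match alpha p v a (ln g) ->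
  x j != v -> (forall i, 0 <= (x i - x j) * (v - x j)) ->
  0 <= (v - p) * (v - x j) ->
  let b := (alpha / p + (1 - alpha) / v)^-1 in
  0 <= (v - x j) * (b^-1 - h^-1) /\ (b = h <-> extremal_config w x p).
Proof.
move=> pv xjv outer far b.
have /andP[alpha0 alpha1] := min_weight_in01.
have bV : b^-1 = alpha / p + (1 - alpha) / v by exact: invrK.
have hV : h^-1 = \sum_i w i / x i by exact: invrK.
have := pv; rewrite ln_geometric_mean => /(harmonic_comparison w_gt0 w_sum1
  x_gt0 alpha0 (min_weight_le j)) /(_ xjv outer far) [].
rewrite -bV -hV => D0 D_eq0; split=> //; split=> [bh|cfg].
  have [|wj xj rest] := D_eq0; first by rewrite bh subrr mulr0.
  by exists j; split=> // l k lj kj; rewrite !rest.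
exact/esym/harmonic_mean_extremal.
Qed.

Lemma harmonic_mean_gt0 : 0 < h.
Proof.
have [i _] := x_not_all_equal.
rewrite invr_gt0 (bigD1 i)//= ltr_wpDr ?divr_gt0//.
by rewrite sumr_ge0// => k _; rewrite divr_ge0// ltW.
Qed.

(** For [s = 1] this is an index of the smallest [x i], for [s = -1] of the
largest; not all [x i] being equal, it is strictly on one side of the mean. *)
Lemma exists_extreme (s : R) : s != 0 ->
  exists j, (forall i, 0 <= (x i - x j) * s) /\ 0 < (a - x j) * s.
Proof.
move=> s0; have [i0 [i1 xi01]] := x_not_all_equal.
have [j _ jmin] := arg_minP (fun i => x i * s) (erefl (predT i0)).
have ge0 i : 0 <= (x i - x j) * s by rewrite mulrBl subr_ge0 jmin.
have term_ge0 i : true -> 0 <= w i * ((x i - x j) * s).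
  by rewrite mulr_ge0// ltW.
exists j; split=> //.
have -> : (a - x j) * s = \sum_i w i * ((x i - x j) * s).
  under eq_bigr do rewrite mulrA mulrBr.
  by rewrite -mulr_suml sumrB -mulr_suml w_sum1 mul1r.
rewrite lt0r sumr_ge0// andbT; apply/eqP => sum0; apply: xi01.
have eq_xj i : x i = x j.
  have /eqP := psumr_eq0P term_ge0 sum0 (i := i) isT.
  by rewrite !mulf_eq0 (negPf s0) gt_eqF//= orbF subr_eq0 => /eqP.
by rewrite !eq_xj.
Qed.

End Means.
End TwoPointComparison.

(** * The bounds on the harmonic mean *)

Theorem theorem1p1 (R : realType) (n : nat) (w x : 'I_n -> R)
    (w_gt0 : forall i, 0 < w i) (x_gt0 : forall i, 0 < x i)
    (w_sum1 : \sum_(i < n) w i = 1)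
    (x_not_all_equal : exists i j : 'I_n, x i <> x j) :
  let h := harmonic_mean w x in
  let g := geometric_mean w x in
  let a := arithmetic_mean w x in
  let alpha := min_weight w in
  (exists! xi0 : R, 0 <= xi0 <= 1 /\ mean_equation g a alpha xi0) /\
  (exists! xi1 : R, 1 <= xi1 <= alpha^-1 /\ mean_equation g a alpha xi1) /\
  (forall xi0 xi1 : R,
     0 <= xi0 <= 1 -> mean_equation g a alpha xi0 ->
     1 <= xi1 <= alpha^-1 -> mean_equation g a alpha xi1 ->
     [/\ harmonic_bound a alpha xi0 <= h,
         h <= harmonic_bound a alpha xi1,
         harmonic_bound a alpha xi0 = h <-> extremal_config w x (a * xi0)
       & h = harmonic_bound a alpha xi1 <-> extremal_config w x (a * xi1)]).
Proof.
move=> h g a alpha.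
have alpha01 : 0 < alpha < 1.
  exact: min_weight_in01 w_gt0 w_sum1 x_not_all_equal.
have /andP[alpha0 alpha1] := alpha01.
have beta0 : 0 < 1 - alpha by rewrite subr_gt0.
have a0 : 0 < a by exact: arithmetic_mean_gt0 x_not_all_equal.
have g0 : 0 < g by exact: geometric_mean_gt0.
have h0 : 0 < h by exact: harmonic_mean_gt0 x_not_all_equal.
have le_inv : 1 <= alpha^-1 by rewrite invf_ge1// ltW.
have range0 xi : 0 <= xi <= 1 -> 0 <= xi <= alpha^-1.
  by move=> /andP[-> /le_trans->].
have range1 xi : 1 <= xi <= alpha^-1 -> 0 <= xi <= alpha^-1.
  by move=> /andP[xi1 ->]; rewrite (le_trans ler01).
pose v xi := a * (1 - alpha * xi) / (1 - alpha).
have match_of xi : 0 <= xi <= alpha^-1 -> mean_equation g a alpha xi ->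
    two_point_match alpha (a * xi) (v xi) a (ln g).
  by move=> r /mean_equationP; apply.
have eq_of s t : two_point_match alpha s t a (ln g) ->
    0 <= s / a <= alpha^-1 /\ mean_equation g a alpha (s / a).
  move=> st; have [s0 t0 mean_eq _] := st.
  have r : 0 <= s / a <= alpha^-1.
    apply/andP; split; first by rewrite divr_ge0// ltW.
    rewrite ler_pdivrMr// ler_pdivlMl// -mean_eq lerDl mulr_ge0//; exact: ltW.
  split=> //; apply/mean_equationP => //.
  have aE : a * (s / a) = s by field; exact: lt0r_neq0.
  have tE : a * (1 - alpha * (s / a)) / (1 - alpha) = t.
    have -> : a * (1 - alpha * (s / a)) = a - alpha * s.
      by field; exact: lt0r_neq0.
    by rewrite -mean_eq; field; exact: lt0r_neq0.
  by rewrite aE tE.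
(* The sign condition holds when [xi'] is between [xi] and [1], so of two
   solutions on the same side of [1] the one closer to [1] is taken as [xi']. *)
have unique xi xi' : 0 <= xi <= alpha^-1 -> 0 <= xi' <= alpha^-1 ->
    mean_equation g a alpha xi -> mean_equation g a alpha xi' ->
    0 <= (xi - xi') * (xi' - 1) -> xi = xi'.
  move=> r r' /(match_of _ r) m /(match_of _ r') m' side.
  apply: (mulfI (lt0r_neq0 a0)); apply: two_point_unique m m' _ => //.
  have -> : (a * xi - a * xi') * (a * xi' - a) =
    a ^+ 2 * ((xi - xi') * (xi' - 1)) by ring.
  by rewrite mulr_ge0// sqr_ge0.
have ln_g_le : ln g <= ln a.
  by rewrite ln_geometric_mean// mean_ln_le.
(* Hence [v xi] and [a * xi] are on opposite sides of [a]. *)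
have v_sub_a xi : v xi - a = a * alpha / (1 - alpha) * (1 - xi).
  by rewrite /v; field; exact: lt0r_neq0.
have slope0 : 0 < a * alpha / (1 - alpha) by rewrite divr_gt0// mulr_gt0.
have boundE xi : 0 <= xi <= alpha^-1 -> mean_equation g a alpha xi ->
    harmonic_bound a alpha xi =
    (alpha / (a * xi) + (1 - alpha) / (v xi))^-1 /\
    0 < harmonic_bound a alpha xi.
  move=> r /(match_of _ r) [].
  rewrite pmulr_rgt0// /v -mulrA pmulr_rgt0// pmulr_lgt0 ?invr_gt0//.
  move=> xi0 eta0 _ _; rewrite harmonic_boundE// mulrA; split=> //.
  by rewrite invr_gt0 addr_gt0 ?divr_gt0 ?mulr_gt0// invr_gt0.
split; [|split].
- have [s [t [sa st]]] := two_point_exists alpha01 a0 ln_g_le.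
  have [r e] := eq_of s t st.
  have r0 : 0 <= s / a <= 1.
    by case/andP: r => -> _; rewrite ler_pdivrMr// mul1r.
  exists (s / a); split=> // xi [r1 e1].
  have [le|/ltW le] := leP (s / a) xi.
    by apply: unique => //; [exact: range0|nra].
  by apply/esym; apply: unique => //; [exact: range0|nra].
- have beta01 : 0 < 1 - alpha < 1 by apply/andP; split; lra.
  have [t [s [ta [t0 s0 mean_eq log_eq]]]] := two_point_exists beta01 a0 ln_g_le.
  have st : two_point_match alpha s t a (ln g).
    by split=> //; [rewrite -mean_eq; ring|rewrite -log_eq; ring].
  have [r e] := eq_of s t st.
  have r0 : 1 <= s / a <= alpha^-1.
    case/andP: r => _ ->; rewrite andbT ler_pdivlMr// mul1r.
    by nra.
  exists (s / a); split=> // xi [r1 e1].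
  have [le|/ltW le] := leP (s / a) xi.
    by apply/esym; apply: unique => //; [exact: range1|nra].
  by apply: unique => //; [exact: range1|nra].
move=> xi0 xi1 r0 e0 r1 e1.
have m0 := match_of _ (range0 _ r0) e0.
have m1 := match_of _ (range1 _ r1) e1.
have [b0E b0_gt0] := boundE _ (range0 _ r0) e0.
have [b1E b1_gt0] := boundE _ (range1 _ r1) e1.
have v0a : a <= v xi0.
  rewrite -subr_ge0 v_sub_a; case/andP: r0 => _ le.
  by rewrite pmulr_rge0// subr_ge0.
have v1a : v xi1 <= a.
  rewrite -subr_le0 v_sub_a; case/andP: r1 => le _.
  by rewrite pmulr_rle0// subr_le0.
have p0a : a * xi0 <= a by case/andP: r0 => _ le; rewrite ger_pMr.
have p1a : a <= a * xi1 by case/andP: r1 => le _; rewrite ler_pMr.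
(* The smallest [x j] is used for [xi0], the largest [x k] for [xi1]. *)
have [j [jmin ja]] := exists_extreme w_gt0 w_sum1 x_not_all_equal (oner_neq0 R).
have N1 : -1 != 0 :> R by rewrite oppr_eq0 oner_neq0.
have [k [kmax ka]] := exists_extreme w_gt0 w_sum1 x_not_all_equal N1.
have vj : 0 < v xi0 - x j by move: ja; rewrite -/a; lra.
have vk : v xi1 - x k < 0 by move: ka; rewrite -/a; lra.
have [|||le0 eq0] := @harmonic_mean_bound R n w x w_gt0 x_gt0 w_sum1
  x_not_all_equal j _ _ m0.
- by rewrite -subr_eq0 -opprB oppr_eq0 gt_eqF.
- by move=> i; have := jmin i; rewrite mulr1 => ?; rewrite mulr_ge0// ltW.
- by rewrite mulr_ge0 ?(ltW vj)// subr_ge0; lra.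
have [|||le1 eq1] := @harmonic_mean_bound R n w x w_gt0 x_gt0 w_sum1
  x_not_all_equal k _ _ m1.
- by rewrite -subr_eq0 -opprB oppr_eq0 lt_eqF.
- move=> i; have := kmax i; rewrite mulrN1 oppr_ge0 => ?.
  by rewrite mulr_le0// ltW.
- by rewrite mulr_le0 ?(ltW vk)// subr_le0; lra.
rewrite -b0E in le0 eq0; rewrite -b1E in le1 eq1.
split=> //.
- by move: le0; rewrite pmulr_rge0// subr_ge0 lef_pV2.
- by move: le1; rewrite nmulr_rge0// subr_le0 lef_pV2.
- by split=> [/esym/eq1|/eq1/esym].
Qed.
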